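(* Suppose each $f_i$ is $l$-smooth and $f=\frac1n\sum_{i=1}^n f_i$ is (possibly) nonconvex in $x$ and $\mu$-strongly concave in $y$, with condition number $\kappa=l/\mu\ge 1$ (in the precise sense given in the context). Let the step sizes satisfy $0<\eta_2\le\frac{1}{8l}$ and $\eta_1=\frac{\eta_2}{r}$ with $r\ge 14\kappa^2$, and suppose they are of order $\eta_1\asymp\frac{1}{\kappa^2 l}$ and $\eta_2\asymp\frac1l$, i.e. $\eta_1\ge \frac{c_1}{\kappa^2 l}$ and $\eta_2\ge\frac{c_2}{l}$ for fixed constants $c_1,c_2>0$. Then the Shuffling Gradient Descent-Ascent with Variance Reduction algorithm (with any of the IG, SO or RR schemes) achieves an $\epsilon$-optimization-stationary point in expectation with $\mathcal{O}(\kappa^2\epsilon^{-2})$ iterations (epochs) and $\mathcal{O}(n\kappa^2\epsilon^{-2})$ gradient oracle calls. That is, there is a constant $C>0$ depending only on $c_1$, $c_2$, $l$ and $\mathcal{P}_4(x_0,y_0)$ such that for every $\epsilon>0$ there is an index $t\le C\kappa^2\epsilon^{-2}$ with $\mathbb{E}[\|\nabla\Phi(x_t)\|]\le\epsilon$, and computing $x_t$ from $(x_0,y_0)$ requires at most $Cn\kappa^2\epsilon^{-2}$ evaluations of component gradients $\nabla f_i$.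
   Context: Problem: $\min_{x\in\mathbb{R}^d}\max_{y\in\mathbb{R}^d} f(x,y):=\frac1n\sum_{i=1}^n f_i(x,y)$, with $f_i:\mathbb{R}^d\times\mathbb{R}^d\to\mathbb{R}$ differentiable. $\|\cdot\|$ is the Euclidean norm. Standing assumptions: (i) each $f_i$ is $l$-smooth, i.e. $\|\nabla f_i(x_1,y_1)-\nabla f_i(x_2,y_2)\|\le l(\|x_1-x_2\|+\|y_1-y_2\|)$ for all $x_1,x_2,y_1,y_2$; (ii) $f$ is nonconvex in $x$ (no convexity in $x$ is assumed) and $\mu$-strongly concave in $y$ with $\mu>0$, and $\kappa:=l/\mu\ge1$. Notation: $\Phi(x):=\max_{y\in\mathbb{R}^d} f(x,y)$; it is known to be differentiable with $\nabla\Phi(x)=\nabla_x f(x,y^*(x))$, where $y^*(x)$ is the unique maximizer of $f(x,\cdot)$. $\Phi^*:=\inf_{x}\Phi(x)$, assumed finite. For $\lambda>0$ the potential function is $\mathcal{P}_\lambda(x,y):=\lambda(\Phi(x)-\Phi^* )+\Phi(x)-f(x,y)$. A point $x$ is an $\epsilon$-optimization-stationary point if $\|\nabla\Phi(x)\|\le\epsilon$. A gradient oracle call is one evaluation of $\nabla f_i(x,y)$ for a single index $i$ at a single point $(x,y)$. Algorithm (Shuffling Gradient Descent-Ascent with Variance Reduction): start from given $x_0,y_0\in\mathbb{R}^d$ with step sizes $\eta_1,\eta_2>0$. In each epoch $t=0,1,2,\ldots$ a permutation $\pi=(\pi^0,\ldots,\pi^{n-1})$ of $\{1,\ldots,n\}$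 is used: under IG (incremental gradient) it is a fixed deterministic permutation; under SO (shuffling once) it is a random permutation drawn once at the start and reused in all epochs; under RR (random reshuffling) a new random permutation is drawn at the start of each epoch. Set $x_t^0=x_t$, $y_t^0=y_t$, and for $j=0,\ldots,n-1$ compute $$h_t^j=\nabla_x f(x_t,y_t)+\nabla_x f_{\pi^j}(x_t^j,y_t^j)-\nabla_x f_{\pi^j}(x_t,y_t),\qquad x_t^{j+1}=x_t^j-\tfrac{\eta_1}{n}h_t^j,$$ $$d_t^j=\nabla_y f(x_t,y_t)+\nabla_y f_{\pi^j}(x_t^j,y_t^j)-\nabla_y f_{\pi^j}(x_t,y_t),\qquad y_t^{j+1}=y_t^j+\tfrac{\eta_2}{n}d_t^j.$$ Then set $x_{t+1}=x_t^n$, $y_{t+1}=y_t^n$. The expectation $\mathbb{E}$ is over the random permutations. *)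

(* Defs.v *)
From mathcomp Require Import all_boot all_order all_fingroup all_algebra.
From mathcomp Require Import all_classical all_reals all_analysis.

Set Implicit Arguments.
Unset Strict Implicit.
Unset Printing Implicit Defensive.

Import Order.TTheory GRing.Theory Num.Theory.
Import numFieldNormedType.Exports.

Local Open Scope classical_set_scope.
Local Open Scope ring_scope.

(** * Euclidean norm and gradients *)

(* The library norm on row vectors is the sup norm. It induces the same
   topology, hence the same derivatives, as the Euclidean norm used here. *)
Definition enorm (R : realType) (m : nat) (v : 'rV[R]_m) : R :=
  Num.sqrt (\sum_(i < m) v 0 i ^+ 2).

Definition grad (R : realType) (m : nat) (g : 'rV[R]_m -> R) (x : 'rV[R]_m) :
    'rV[R]_m :=
  \row_(j < m) 'D_(delta_mx 0 j) g x.

(* A pair (x, y) of points of R^d; also used for gradients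
   (nabla_x g, nabla_y g). *)
Definition point (R : realType) (d : nat) : Type := ('rV[R]_d * 'rV[R]_d)%type.

Definition gradx (R : realType) (d : nat) (g : 'rV[R]_d * 'rV[R]_d -> R)
    (z : point R d) : 'rV[R]_d :=
  grad (fun x => g (x, z.2)) z.1.

Definition grady (R : realType) (d : nat) (g : 'rV[R]_d * 'rV[R]_d -> R)
    (z : point R d) : 'rV[R]_d :=
  grad (fun y => g (z.1, y)) z.2.

(** * The minimax problem *)

Definition smooth (R : realType) (d : nat) (l : R)
    (g : 'rV[R]_d * 'rV[R]_d -> R) : Prop :=
  (forall z, differentiable g z) /\
  (forall z1 z2 : point R d,
     enorm (row_mx (gradx g z1 - gradx g z2) (grady g z1 - grady g z2))
       <= l * (enorm (z1.1 - z2.1) + enorm (z1.2 - z2.2))).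

Definition strongly_concave (R : realType) (m : nat) (mu : R)
    (g : 'rV[R]_m -> R) : Prop :=
  forall (y1 y2 : 'rV[R]_m) (a : R), 0 <= a <= 1 ->
    a * g y1 + (1 - a) * g y2 + mu / 2 * (a * (1 - a)) * enorm (y1 - y2) ^+ 2
      <= g (a *: y1 + (1 - a) *: y2).

Definition average (R : realType) (d n : nat)
    (f : 'I_n -> 'rV[R]_d * 'rV[R]_d -> R) (z : 'rV[R]_d * 'rV[R]_d) : R :=
  n%:R^-1 * \sum_(i < n) f i z.

(* max_y g (x, y): when g is continuous and strongly concave in y the
   supremum is finite and attained. *)
Definition Phi (R : realType) (d : nat) (g : 'rV[R]_d * 'rV[R]_d -> R)
    (x : 'rV[R]_d) : R :=
  sup (range (fun y : 'rV[R]_d => g (x, y))).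

Definition Phi_star (R : realType) (d : nat)
    (g : 'rV[R]_d * 'rV[R]_d -> R) : R :=
  inf (range (Phi g)).

Definition potential (R : realType) (d : nat)
    (g : 'rV[R]_d * 'rV[R]_d -> R) (lambda : R) (z : point R d) : R :=
  lambda * (Phi g z.1 - Phi_star g) + Phi g z.1 - g z.

(** * Shuffling gradient descent-ascent with variance reduction *)

(* One inner update from z = (x_t^j, y_t^j), with snapshot z0 = (x_t, y_t) and
   component index i = pi^j. *)
Definition sgda_step (R : realType) (d n : nat)
    (f : 'I_n -> 'rV[R]_d * 'rV[R]_d -> R) (eta1 eta2 : R)
    (z0 : point R d) (z : point R d) (i : 'I_n) : point R d :=
  let F := average f in
  (z.1 - (eta1 / n%:R) *: (gradx F z0 + gradx (f i) z - gradx (f i) z0),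
   z.2 + (eta2 / n%:R) *: (grady F z0 + grady (f i) z - grady (f i) z0)).

Definition sgda_epoch (R : realType) (d n : nat)
    (f : 'I_n -> 'rV[R]_d * 'rV[R]_d -> R) (eta1 eta2 : R)
    (s : 'S_n) (z0 : point R d) : point R d :=
  foldl (fun z (j : 'I_n) => sgda_step f eta1 eta2 z0 z (s j)) z0 (enum 'I_n).

(* (x_t, y_t), where s t is the permutation used in epoch t. *)
Fixpoint sgda (R : realType) (d n : nat)
    (f : 'I_n -> 'rV[R]_d * 'rV[R]_d -> R) (eta1 eta2 : R)
    (s : nat -> 'S_n) (z0 : point R d) (t : nat) : point R d :=
  if t is t'.+1 then sgda_epoch f eta1 eta2 (s t') (sgda f eta1 eta2 s z0 t')
  else z0.

(** * Shuffling schemes *)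

Definition uniform_perm (disp : measure_display) (T : measurableType disp)
    (R : realType) (P : probability T R) (n : nat) (X : T -> 'S_n) : Prop :=
  forall s : 'S_n,
    measurable (X @^-1` [set s]) /\ P (X @^-1` [set s]) = ((n`!)%:R^-1)%:E.

Definition independent_perms (disp : measure_display) (T : measurableType disp)
    (R : realType) (P : probability T R) (n : nat) (X : nat -> T -> 'S_n) :
    Prop :=
  forall (J : seq nat) (B : nat -> set 'S_n), uniq J ->
    P (\bigcap_(t in [set` J]) (X t @^-1` B t))
      = (\prod_(t <- J) P (X t @^-1` B t))%E.

(* Incremental gradient, shuffling once, random reshuffling. *)
Inductive scheme : Type := IG | SO | RR.

Definition shuffling (disp : measure_display) (T : measurableType disp)
    (R : realType) (P : probability T R) (n : nat) (sch : scheme)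
    (X : nat -> T -> 'S_n) : Prop :=
  match sch with
  | IG => exists s : 'S_n, forall t w, X t w = s
  | SO => uniform_perm P (X 0%N) /\ forall t w, X t w = X 0%N w
  | RR => (forall t, uniform_perm P (X t)) /\ independent_perms P X
  end.

(** * Oracle complexity *)

(* Computations of a value in A that access the components f_1, ..., f_n only
   through a gradient oracle: [Call i z k] evaluates the gradient of f_i at z
   and continues with k applied to the answer. *)
Inductive prog (R : realType) (d n : nat) (A : Type) : Type :=
  | Ret of A
  | Call of 'I_n & point R d & (point R d -> prog R d n A).

Arguments Ret {R d n A} _.
Arguments Call {R d n A} _ _ _.

Fixpoint bind (R : realType) (d n : nat) (A B : Type) (p : prog R d n A)
    (k : A -> prog R d n B) : prog R d n B :=
  match p with
  | Ret a => k a
  | Call i z q => Call i z (fun g => bind (q g) k)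
  end.

(* The value computed by p, paired with the number of gradient evaluations. *)
Fixpoint run (R : realType) (d n : nat) (A : Type)
    (f : 'I_n -> 'rV[R]_d * 'rV[R]_d -> R) (p : prog R d n A) : A * nat :=
  match p with
  | Ret a => (a, 0%N)
  | Call i z q =>
      let: (a, c) := run f (q (gradx (f i) z, grady (f i) z)) in (a, c.+1)
  end.

(* The component gradients at the point z, for the indices in r. *)
Fixpoint gradients_prog (R : realType) (d n : nat) (z : point R d)
    (r : seq 'I_n) : prog R d n ('I_n -> point R d) :=
  if r is i :: r' then
    Call i z (fun g => bind (gradients_prog z r') (fun G =>
      Ret (fun k => if k == i then g else G k)))
  else Ret (fun=> (0, 0)).

(* The inner loop along the indices in r, from the current point z; G holds the
   component gradients stored at the beginning of the epoch. *)
Fixpoint inner_prog (R : realType) (d n : nat) (eta1 eta2 : R)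
    (G : 'I_n -> point R d) (r : seq 'I_n) (z : point R d) :
    prog R d n (point R d) :=
  if r is i :: r' then
    Call i z (fun g => inner_prog eta1 eta2 G r'
      (z.1 - (eta1 / n%:R) *:
               (n%:R^-1 *: (\sum_(k < n) (G k).1) + g.1 - (G i).1),
       z.2 + (eta2 / n%:R) *:
               (n%:R^-1 *: (\sum_(k < n) (G k).2) + g.2 - (G i).2)))
  else Ret z.

(* The algorithm as an oracle computation of (x_t, y_t). *)
Fixpoint sgda_prog (R : realType) (d n : nat) (eta1 eta2 : R)
    (s : nat -> 'S_n) (z0 : point R d) (t : nat) : prog R d n (point R d) :=
  if t is t'.+1 then
    bind (sgda_prog eta1 eta2 s z0 t') (fun z =>
    bind (gradients_prog z (enum 'I_n)) (fun G =>
    inner_prog eta1 eta2 G [seq s t' j | j <- enum 'I_n] z))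
  else Ret z0.

(* Main.v *)
Require Import Defs.
From mathcomp Require Import all_boot all_order all_fingroup all_algebra.
From mathcomp Require Import all_classical all_reals all_analysis.
From mathcomp Require Import ring lra.

Set Implicit Arguments.
Unset Strict Implicit.
Unset Printing Implicit Defensive.

Import Order.TTheory GRing.Theory Num.Theory.
Import numFieldNormedType.Exports.

Local Open Scope classical_set_scope.
Local Open Scope ring_scope.

(** The descent of the potential P_4 holds for every order of the components, so
    the argument is deterministic and randomness enters only in the last step.

    One epoch is a perturbed simultaneous step: it moves [x] by
    [- eta1 (gradx F + ex)] and [y] by [eta2 (grady F + ey)], because the [n]
    estimators each contain the full gradient at the snapshot and deviate from it by
    at most [l] times the distance travelled within the epoch.  As
    [l (eta1 + eta2)] is small, that distance is of order
    [eta1 |gradx F| + eta2 |grady F|] ([sgda_epoch_step]).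

    On the side of Phi, strong concavity provides a maximizer [y0] of [F (x, .)], and
    the distance from [y] to it is at most [|grady F (x, y)| / mu].  Hence maximizers
    depend on [x] in a Lipschitz way, Phi is differentiable with gradient
    [gradx F (x, y0)] and has a quadratic Taylor error of order [l kappa]
    ([Phi_taylor], [grad_Phi]), and [gradx F (x, y)] differs from [grad Phi x] by
    at most [kappa |grady F (x, y)|].

    In the potential, the step in [x] gains [eta1 |grad Phi|^2] and loses a multiple of
    [eta1 kappa^2 |grady F|^2]; the step in [y] gains [eta2 |grady F|^2] through the term
    [- F].  The ratio [eta2 / eta1 >= 14 kappa^2] of the step sizes makes the gain absorb
    the loss, so an epoch decreases the potential by at least [eta1 |grad Phi|^2]
    ([potential_epoch]).  Telescoping bounds the sum of [|grad Phi (x_k)|^2] over any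
    number of epochs by [P_4 (x_0, y_0) / eta1], which is of order [kappa^2].  By
    Cauchy-Schwarz the sum of the norms over [N] epochs is [O (sqrt N kappa)], uniformly
    over the sample space, and averaging gives an epoch below [eps] in expectation as
    soon as [N] exceeds a multiple of [kappa^2 / eps^2] ([exists_expectation_le]).  Each
    epoch costs [2 n] oracle calls ([run_sgda_prog]). *)

(** * Euclidean geometry of row vectors *)

Section Euclid.
Context {R : realType}.

Definition dot (m : nat) (u v : 'rV[R]_m) : R := \sum_(i < m) u 0 i * v 0 i.

Variable m : nat.
Implicit Types (u v w : 'rV[R]_m) (a : R).

Lemma dotC u v : dot u v = dot v u.
Proof. by apply: eq_bigr => i _; rewrite mulrC. Qed.

Lemma dotDl u v w : dot (u + v) w = dot u w + dot v w.
Proof. by rewrite -big_split; apply: eq_bigr => i _; rewrite mxE mulrDl. Qed.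

Lemma dotZl a u w : dot (a *: u) w = a * dot u w.
Proof. by rewrite mulr_sumr; apply: eq_bigr => i _; rewrite mxE mulrA. Qed.

Lemma dotNl u w : dot (- u) w = - dot u w.
Proof. by rewrite -scaleN1r dotZl mulN1r. Qed.

Lemma dotBl u v w : dot (u - v) w = dot u w - dot v w.
Proof. by rewrite dotDl dotNl. Qed.

Lemma dotDr u v w : dot w (u + v) = dot w u + dot w v.
Proof. by rewrite !(dotC w) dotDl. Qed.

Lemma dotZr a u w : dot w (a *: u) = a * dot w u.
Proof. by rewrite !(dotC w) dotZl. Qed.

Lemma dotNr u w : dot w (- u) = - dot w u.
Proof. by rewrite !(dotC w) dotNl. Qed.

Lemma dotBr u v w : dot w (u - v) = dot w u - dot w v.
Proof. by rewrite dotDr dotNr. Qed.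

Lemma dot_ge0 u : 0 <= dot u u.
Proof. by apply: sumr_ge0 => i _; rewrite -expr2 sqr_ge0. Qed.

Lemma enorm_ge0 u : 0 <= enorm u.
Proof. exact: sqrtr_ge0. Qed.

Lemma sqr_enorm u : enorm u ^+ 2 = dot u u.
Proof.
rewrite sqr_sqrtr; first by apply: eq_bigr => i _; rewrite expr2.
by apply: sumr_ge0 => i _; rewrite sqr_ge0.
Qed.

Lemma enorm_le u a : 0 <= a -> dot u u <= a ^+ 2 -> enorm u <= a.
Proof.
by move=> a0; rewrite -sqr_enorm ler_pXn2r // nnegrE enorm_ge0.
Qed.

Lemma enormZ a u : enorm (a *: u) = `|a| * enorm u.
Proof.
apply/eqP; rewrite -(@eqrXn2 _ 2) ?mulr_ge0 ?enorm_ge0 //.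
by rewrite exprMn !sqr_enorm dotZl dotZr real_normK ?num_real // mulrA expr2.
Qed.

Lemma enormN u : enorm (- u) = enorm u.
Proof. by rewrite -scaleN1r enormZ normrN1 mul1r. Qed.

Lemma enorm0 : enorm (0 : 'rV[R]_m) = 0.
Proof. by rewrite -(scale0r 0) enormZ normr0 mul0r. Qed.

Lemma enormC u v : enorm (u - v) = enorm (v - u).
Proof. by rewrite -enormN opprB. Qed.

Lemma enorm_eq0 u : enorm u = 0 -> u = 0.
Proof.
move=> u0; have /eqP : dot u u = 0 by rewrite -sqr_enorm u0 expr0n.
rewrite psumr_eq0 => [/allP h|i _]; last by rewrite -expr2 sqr_ge0.
apply/rowP => i; rewrite mxE; apply/eqP.
by have := h i (mem_index_enum i); rewrite mulf_eq0 orbb.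
Qed.

(** With [a] and [b] the norms of [u] and [v], expand the square of
    [b u - a v] into [2 a b (a b - dot u v)]. *)
Lemma dot_le_enorm u v : dot u v <= enorm u * enorm v.
Proof.
have zero w z : enorm w = 0 -> dot w z <= enorm w * enorm z.
  by move=> w0; rewrite w0 mul0r (enorm_eq0 w0) -(scale0r 0) dotZl mul0r.
have [/zero //|u0] := eqVneq (enorm u) 0.
have [v0|v0] := eqVneq (enorm v) 0; first by rewrite dotC mulrC zero.
have up : 0 < enorm u by rewrite lt0r u0 enorm_ge0.
have vp : 0 < enorm v by rewrite lt0r v0 enorm_ge0.
have := dot_ge0 (enorm v *: u - enorm u *: v).
rewrite dotBl !dotBr !dotZl !dotZr -!sqr_enorm (dotC v u).
set a := enorm u in up *; set b := enorm v in vp *; set d := dot u v.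
have -> : b * (b * a ^+ 2) - b * (a * d) - (a * (b * d) - a * (a * b ^+ 2))
        = 2 * (a * b) * (a * b - d) by ring.
by rewrite pmulr_rge0 ?subr_ge0 // !mulr_gt0.
Qed.

Lemma ler_norm_dot u v : `|dot u v| <= enorm u * enorm v.
Proof.
rewrite ler_norml dot_le_enorm andbT lerNl -dotNl -(enormN u).
exact: dot_le_enorm.
Qed.

Lemma ler_enormD u v : enorm (u + v) <= enorm u + enorm v.
Proof.
apply: enorm_le; first by rewrite addr_ge0 ?enorm_ge0.
rewrite dotDl !dotDr (dotC v u) -!sqr_enorm.
have := dot_le_enorm u v; lra.
Qed.

Lemma ler_enorm_sum (I : Type) (r : seq I) (F : I -> 'rV[R]_m) :
  enorm (\sum_(i <- r) F i) <= \sum_(i <- r) enorm (F i).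
Proof.
elim: r => [|i r ih]; first by rewrite !big_nil enorm0.
rewrite !big_cons; apply: (le_trans (ler_enormD _ _)).
by rewrite lerD2l.
Qed.

Lemma enorm_delta (j : 'I_m) : enorm (delta_mx 0 j : 'rV[R]_m) = 1.
Proof.
rewrite /enorm (bigD1 j) //= mxE !eqxx expr1n big1 ?addr0 ?sqrtr1 // => i ij.
by rewrite mxE (negPf ij) andbF expr0n.
Qed.

Lemma dot_delta u (j : 'I_m) : dot u (delta_mx 0 j) = u 0 j.
Proof.
rewrite /dot (bigD1 j) //= mxE !eqxx mulr1 big1 ?addr0 // => i ij.
by rewrite mxE (negPf ij) andbF mulr0.
Qed.

Lemma mx_norm_le_enorm u : `|u| <= enorm u.
Proof.
rewrite /Num.norm /= mx_normrE bigmax_le ?enorm_ge0 // => -[i j] _ /=.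
rewrite ord1 -dot_delta -[leRHS]mulr1 -(enorm_delta j).
exact: ler_norm_dot.
Qed.

End Euclid.

Lemma dot_row_mx (R : realType) (m p : nat) (u u' : 'rV[R]_m) (v v' : 'rV[R]_p) :
  dot (row_mx u v) (row_mx u' v') = dot u u' + dot v v'.
Proof.
rewrite /dot big_split_ord /=; congr (_ + _); apply: eq_bigr => i _.
  by rewrite !row_mxEl.
by rewrite !row_mxEr.
Qed.

Lemma enorm_lsubmx (R : realType) (m p : nat) (u : 'rV[R]_m) (v : 'rV[R]_p) :
  enorm u <= enorm (row_mx u v).
Proof.
apply: enorm_le (enorm_ge0 _) _.
by rewrite sqr_enorm dot_row_mx lerDl dot_ge0.
Qed.

Lemma enorm_rsubmx (R : realType) (m p : nat) (u : 'rV[R]_m) (v : 'rV[R]_p) :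
  enorm v <= enorm (row_mx u v).
Proof.
apply: enorm_le (enorm_ge0 _) _.
by rewrite sqr_enorm dot_row_mx lerDr dot_ge0.
Qed.

(** * Gradients as representatives of the differential *)

Section Gradient.
Context {R : realType} {d : nat}.
Implicit Types (g : 'rV[R]_d * 'rV[R]_d -> R) (z w : 'rV[R]_d * 'rV[R]_d).

Lemma gradxE g z : differentiable g z ->
  gradx g z = \row_j 'd g z (delta_mx 0 j, 0).
Proof.
case: z => x y /= dg; apply/rowP => j; rewrite !mxE -deriveE // /derive /=.
congr (lim (_ @ 0^')); apply/funext => h; rewrite /shift /=.
have -> : h *: (delta_mx 0 j, 0) + (x, y) = (h *: delta_mx 0 j + x, h *: 0 + y)
  :> 'rV[R]_d * 'rV[R]_d by [].
by rewrite scaler0 add0r.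
Qed.

Lemma gradyE g z : differentiable g z ->
  grady g z = \row_j 'd g z (0, delta_mx 0 j).
Proof.
case: z => x y /= dg; apply/rowP => j; rewrite !mxE -deriveE // /derive /=.
congr (lim (_ @ 0^')); apply/funext => h; rewrite /shift /=.
have -> : h *: (0, delta_mx 0 j) + (x, y) = (h *: 0 + x, h *: delta_mx 0 j + y)
  :> 'rV[R]_d * 'rV[R]_d by [].
by rewrite scaler0 add0r.
Qed.

Lemma diff_dot_grad g z w : differentiable g z ->
  'd g z w = dot (gradx g z) w.1 + dot (grady g z) w.2.
Proof.
case: w => u v dg.
have h : (u, v) = \sum_(j < d) u 0 j *: (delta_mx 0 j, 0)
                 + \sum_(j < d) v 0 j *: (0, delta_mx 0 j) :> 'rV[R]_d * 'rV[R]_d.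
  rewrite [in LHS](row_sum_delta u) [in LHS](row_sum_delta v).
  congr pair; rewrite /=.
    rewrite !(big_morph fst (fun _ _ => erefl) erefl) /=.
    by rewrite [X in _ = _ + X]big1 ?addr0 // => j _; rewrite scaler0.
  rewrite !(big_morph snd (fun _ _ => erefl) erefl) /=.
  by rewrite [X in _ = X + _]big1 ?add0r // => j _; rewrite scaler0.
rewrite [in LHS]h linearD !linear_sum gradxE // gradyE //=; congr (_ + _).
  by apply: eq_bigr => j _; rewrite linearZ mxE mulrC.
by apply: eq_bigr => j _; rewrite linearZ mxE mulrC.
Qed.

(** The mean value theorem for [s |-> g (z + s *: w)] on the unit interval. *)
Lemma mean_value_grad g z w : (forall z, differentiable g z) ->
  exists2 c : R, 0 <= c <= 1 &
    g (z + w) - g z = dot (gradx g (z + c *: w)) w.1 + dot (grady g (z + c *: w)) w.2.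
Proof.
move=> dg.
have der (t : R) : is_derive t 1 (fun s : R => g (z + s *: w)) ('d g (z + t *: w) w).
  have E : (fun h : R => h^-1 *: (((fun s : R => g (z + s *: w)) \o shift t) (h *: 1)
      - g (z + t *: w))) = (fun h => h^-1 *: ((g \o shift (z + t *: w)) (h *: w) - g (z + t *: w))).
    apply/funext => h /=.
    by rewrite /shift /= scaler1 scalerDl addrCA.
  apply: DeriveDef.
    by rewrite /derivable E; exact: diff_derivable.
  by rewrite /derive E -deriveE.
have [|c c01] := @MVT_segment R (fun s => g (z + s *: w)) _ 0 1 ler01 (fun t _ => der t).
  apply: derivable_within_continuous => t _. exact: ex_derive.
rewrite scale1r scale0r addr0 subr0 mulr1 diff_dot_grad // => ->.
by exists c.
Qed.

End Gradient.

(** * Smooth functions *)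

Section Smooth.
Context {R : realType} {d : nat}.
Implicit Types (g : 'rV[R]_d * 'rV[R]_d -> R) (z w : 'rV[R]_d * 'rV[R]_d).

Section Average.
Variables (n : nat) (f : 'I_n -> 'rV[R]_d * 'rV[R]_d -> R).
Hypothesis df : forall i z, differentiable (f i) z.

Let averageE : average f = n%:R^-1 \*: (\sum_(i < n) f i).
Proof. by apply/funext => z; rewrite /average /= fct_sumE. Qed.

Lemma differentiable_average z : differentiable (average f) z.
Proof. by rewrite averageE; apply: differentiableZ; apply: differentiable_sum. Qed.

Let diff_average z w :
  'd (average f) z w = n%:R^-1 * \sum_(i < n) 'd (f i) z w.
Proof.
rewrite -deriveE; last exact: differentiable_average.
rewrite averageE deriveZ; last by apply: derivable_sum => i; apply: diff_derivable.
rewrite derive_sum; last by move=> i; apply: diff_derivable.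
by congr (_ * _); apply: eq_bigr => i _; rewrite deriveE.
Qed.

Lemma gradx_average z :
  gradx (average f) z = n%:R^-1 *: \sum_(i < n) gradx (f i) z.
Proof.
rewrite gradxE; last exact: differentiable_average.
apply/rowP => j; rewrite !mxE diff_average summxE; congr (_ * _).
by apply: eq_bigr => i _; rewrite gradxE // mxE.
Qed.

Lemma grady_average z :
  grady (average f) z = n%:R^-1 *: \sum_(i < n) grady (f i) z.
Proof.
rewrite gradyE; last exact: differentiable_average.
apply/rowP => j; rewrite !mxE diff_average summxE; congr (_ * _).
by apply: eq_bigr => i _; rewrite gradyE // mxE.
Qed.

End Average.

Lemma smooth_average n (f : 'I_n -> 'rV[R]_d * 'rV[R]_d -> R) l :
  (0 < n)%N -> (forall i, smooth l (f i)) -> smooth l (average f).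
Proof.
move=> n0 fl; have df i z : differentiable (f i) z by case: (fl i).
split=> [z|z1 z2]; first exact: differentiable_average.
rewrite !gradx_average // !grady_average // -!scalerBr -!sumrB -scale_row_mx.
have -> : row_mx (\sum_(i < n) (gradx (f i) z1 - gradx (f i) z2))
                 (\sum_(i < n) (grady (f i) z1 - grady (f i) z2))
   = \sum_(i < n) row_mx (gradx (f i) z1 - gradx (f i) z2) (grady (f i) z1 - grady (f i) z2).
  by elim/big_rec3: _ => [|i a b c _ <-]; rewrite ?row_mx0 ?add_row_mx.
rewrite enormZ ger0_norm ?invr_ge0 // ler_pdivrMl ?ltr0n //.
apply: (le_trans (ler_enorm_sum _ _)).
apply: (@le_trans _ _ (\sum_(i < n) l * (enorm (z1.1 - z2.1) + enorm (z1.2 - z2.2)))).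
  by apply: ler_sum => i _; case: (fl i).
by rewrite sumr_const card_ord mulr_natl.
Qed.

Variables (l : R) (g : 'rV[R]_d * 'rV[R]_d -> R).
Hypothesis gl : smooth l g.

Lemma smooth_gradx z1 z2 :
  enorm (gradx g z1 - gradx g z2) <= l * (enorm (z1.1 - z2.1) + enorm (z1.2 - z2.2)).
Proof. by case: gl => _ h; apply: le_trans (h z1 z2); apply: enorm_lsubmx. Qed.

Lemma smooth_grady z1 z2 :
  enorm (grady g z1 - grady g z2) <= l * (enorm (z1.1 - z2.1) + enorm (z1.2 - z2.2)).
Proof. by case: gl => _ h; apply: le_trans (h z1 z2); apply: enorm_rsubmx. Qed.

(** The mean value theorem replaces the increment by a gradient on the segment,
    whose distance to the gradient at [z] is controlled by smoothness. *)
Lemma smooth_taylor z w : 0 <= l ->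
  `|g (z + w) - g z - (dot (gradx g z) w.1 + dot (grady g z) w.2)|
     <= l * (enorm w.1 + enorm w.2) ^+ 2.
Proof.
move=> l0; have [c /andP[c0 c1] ->] := mean_value_grad z w gl.1.
rewrite opprD addrACA -!dotBl.
apply: (le_trans (ler_normD _ _)).
have bound v (G : 'rV[R]_d) :
   enorm G <= l * (enorm (z + c *: w - z).1 + enorm (z + c *: w - z).2) ->
   `|dot G v| <= l * (enorm w.1 + enorm w.2) * enorm v.
  move=> h; apply: (le_trans (ler_norm_dot _ _)).
  rewrite ler_wpM2r ?enorm_ge0 //; apply: (le_trans h); rewrite ler_wpM2l //.
  rewrite addrAC subrr add0r !enormZ ger0_norm // -mulrDr.
  by rewrite ler_piMl // addr_ge0 ?enorm_ge0.
rewrite expr2 mulrA mulrDr lerD //.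
  by apply: bound; apply: smooth_gradx.
by apply: bound; apply: smooth_grady.
Qed.

Lemma smooth_taylor_x x y v : 0 <= l ->
  `|g (x + v, y) - g (x, y) - dot (gradx g (x, y)) v| <= l * enorm v ^+ 2.
Proof.
move=> l0; have := smooth_taylor (x, y) (v, 0) l0.
by rewrite -[(x, y) + _]/(x + v, y + 0) addr0 /= enorm0 addr0 -(scale0r 0) dotZr mul0r addr0.
Qed.

Lemma smooth_taylor_y x y v : 0 <= l ->
  `|g (x, y + v) - g (x, y) - dot (grady g (x, y)) v| <= l * enorm v ^+ 2.
Proof.
move=> l0; have := smooth_taylor (x, y) (0, v) l0.
by rewrite -[(x, y) + _]/(x + 0, y + v) addr0 /= enorm0 add0r -(scale0r 0) dotZr mul0r add0r.
Qed.

End Smooth.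

(** * The primal function *)

(** A quadratic error term identifies the gradient: the difference quotient in
    the direction of a unit vector is then within a multiple of the step. *)
Lemma grad_taylor (R : realType) (m : nat) (h : 'rV[R]_m -> R) (x G : 'rV[R]_m) (C : R) :
  (forall v, `|h (x + v) - h x - dot G v| <= C * enorm v ^+ 2) -> grad h x = G.
Proof.
move=> hG; apply/rowP => j; rewrite mxE /derive; apply/cvg_lim => //.
have C0 : 0 <= C.
  have := hG (delta_mx 0 j); rewrite enorm_delta expr1n mulr1; exact: le_trans.
apply/cvgrPdist_le => e e0; near=> t.
have t0 : t != 0 by near: t; exact: nbhs_dnbhs_neq.
have te : `|t| <= e / (C + 1).
  near: t; apply: dnbhs0_le; by rewrite divr_gt0 // ltr_wpDl.
rewrite /shift /= [_ *: _ + x]addrC distrC.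
have := hG (t *: delta_mx 0 j); rewrite enormZ enorm_delta mulr1 dotZr dot_delta => ht.
have -> : t^-1 *: (h (x + t *: 'e_j) - h x) - G 0 j = t^-1 * (h (x + t *: 'e_j) - h x - t * G 0 j).
  by rewrite mulrBr mulrA mulVf // mul1r.
rewrite normrM normfV ler_pdivrMl ?normr_gt0 //; apply: (le_trans ht).
rewrite expr2 mulrCA ler_wpM2l //.
apply: (@le_trans _ _ (C * (e / (C + 1)))); first by rewrite ler_wpM2l.
by rewrite mulrCA ler_piMr ?(ltW e0) // ler_pdivrMr ?ltr_wpDl // mul1r lerDl.
Unshelve. all: by end_near. Qed.

Section Max.
Context {R : realType} {d : nat}.
Variables (g : 'rV[R]_d * 'rV[R]_d -> R) (l mu : R).
Hypotheses (gl : smooth l g) (l0 : 0 <= l) (mu0 : 0 < mu).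
Hypothesis gmu : forall x, strongly_concave mu (fun y => g (x, y)).
Implicit Types (x y v w : 'rV[R]_d).

(** First-order form of strong concavity: compare the chord from [y] to [y + w]
    with the tangent at [y] after a step of relative length [a], divide by [a] and let
    [a] tend to [0]. *)
Lemma strongly_concave_tangent x y w :
  g (x, y + w) <= g (x, y) + dot (grady g (x, y)) w - mu / 2 * enorm w ^+ 2.
Proof.
set X := g (x, y + w) - g (x, y) - dot (grady g (x, y)) w + mu / 2 * enorm w ^+ 2.
suff : X <= 0 by rewrite /X; lra.
rewrite leNgt; apply/negP => X0.
set N := (mu / 2 + l) * enorm w ^+ 2.
have N0 : 0 <= N.
  by rewrite mulr_ge0 ?sqr_ge0 // addr_ge0 // divr_ge0 // ltW.
have XN : 0 < X + N by rewrite ltr_pwDl.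
set a := X / (X + N).
have a0 : 0 < a by rewrite divr_gt0.
have a1 : a <= 1 by rewrite ler_pdivrMr // mul1r lerDl.
have : X <= a * N.
  rewrite -(ler_pM2l a0).
  have /(gmu x (y + w) y) : 0 <= a <= 1 by rewrite (ltW a0).
  have -> : a *: (y + w) + (1 - a) *: y = y + a *: w.
    by rewrite scalerDr addrAC -scalerDl [a + _]addrC subrK scale1r.
  have := smooth_taylor_y gl x y (a *: w) l0.
  rewrite ler_norml => /andP[_].
  have -> : y + w - y = w by rewrite addrC addKr.
  rewrite enormZ exprMn real_normK ?num_real // dotZr /= /X /N.
  lra.
by rewrite /a mulrAC ler_pdivlMr // ler_pM2l // leNgt ltr_pwDl.
Qed.

Definition maximizer x y := forall y', g (x, y') <= g (x, y).

(** The tangent bound at [0] puts every point outside a ball below [g (x, 0)],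
    so a maximum over that compact ball is global. *)
Lemma exists_maximizer x : exists y, maximizer x y.
Proof.
set G := grady g (x, 0); pose rho := 2 * enorm G / mu.
have rho0 : 0 <= rho by rewrite divr_ge0 ?mulr_ge0 ?enorm_ge0 // ltW.
pose A := closed_ball_ Num.norm (0 : 'rV[R]_d) rho.
have inA y : (y \in A) = (`|y| <= rho).
  by apply/idP/idP; rewrite inE /A /closed_ball_ /= sub0r normrN.
have A0 : 0 \in A by rewrite inA normr0.
have cA : compact A.
  apply: bounded_closed_compact; last exact: closed_closed_ball_.
  exists rho; split=> [|M rM y]; first exact: num_real.
  by rewrite /A /closed_ball_ /= sub0r normrN => /le_trans; apply; exact: ltW.
have cg : {within A, continuous (fun y => g (x, y))}.
  apply: continuous_subspaceT => y.
  apply: differentiable_continuous.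
  by apply: (@differentiable_comp _ _ _ _ (fun y => (x, y)) g) (gl.1 _).
have [|y _ ymax] := EVT_max_rV _ cA cg; first by exists 0; rewrite inE in A0.
exists y => y'; have [/ymax //|] := boolP (y' \in A).
rewrite inA -ltNge => yr; apply: le_trans (ymax _ A0).
have {}yr : rho < enorm y' by apply: lt_le_trans yr (mx_norm_le_enorm _).
have := strongly_concave_tangent x 0 y'; rewrite add0r => /le_trans; apply.
rewrite -addrA gerDl subr_le0; apply: (le_trans (dot_le_enorm _ _)).
rewrite expr2 mulrA ler_wpM2r ?enorm_ge0 //.
by move: yr; rewrite /rho ltr_pdivrMr // => /ltW; rewrite -/G; lra.
Qed.

(** A step of [1 / (2 l)] times the gradient raises the value by at least [|G|^2 / (4 l)]. *)
Lemma grady_maximizer x y : 0 < l -> maximizer x y -> grady g (x, y) = 0.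
Proof.
move=> lp ymax; apply: enorm_eq0; set G := grady g (x, y).
have := smooth_taylor_y gl x y ((2 * l)^-1 *: G) l0.
rewrite ler_norml => /andP[+ _].
have := ymax (y + (2 * l)^-1 *: G).
rewrite enormZ exprMn real_normK ?num_real // dotZr -sqr_enorm => h1 h2.
have : (2 * l)^-1 * enorm G ^+ 2 - l * ((2 * l)^-1 ^+ 2 * enorm G ^+ 2) <= 0 by lra.
have -> : (2 * l)^-1 * enorm G ^+ 2 - l * ((2 * l)^-1 ^+ 2 * enorm G ^+ 2)
        = (4 * l)^-1 * enorm G ^+ 2 by field; rewrite gt_eqF.
rewrite pmulr_rle0 ?invr_gt0 ?mulr_gt0 // => h.
by apply/eqP; rewrite -sqrf_eq0 eq_le h sqr_ge0.
Qed.

(** Add the tangent bounds at [y] and at the maximizer, where the gradient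
    vanishes. *)
Lemma dist_maximizer x y0 y : 0 < l -> maximizer x y0 ->
  mu * enorm (y - y0) <= enorm (grady g (x, y)).
Proof.
move=> lp y0max; have [->|D0] := eqVneq (enorm (y - y0)) 0.
  by rewrite mulr0 enorm_ge0.
have Dp : 0 < enorm (y - y0) by rewrite lt0r D0 enorm_ge0.
rewrite -(ler_pM2r Dp).
have := strongly_concave_tangent x y0 (y - y0); rewrite addrC subrK grady_maximizer //.
rewrite -(scale0r 0) dotZl mul0r.
have := strongly_concave_tangent x y (y0 - y); rewrite [y + _]addrC subrK.
have := dot_le_enorm (grady g (x, y)) (y0 - y).
rewrite (enormC y0); lra.
Qed.

Lemma Phi_maximizer x y : maximizer x y -> Phi g x = g (x, y).
Proof.
move=> ymax; apply/eqP; rewrite eq_le; apply/andP; split.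
  by apply: ge_sup => [|_ [y' _ <-]]; [exists (g (x, y)); exists y|exact: ymax].
apply: ub_le_sup; last by exists y.
by exists (g (x, y)) => _ [y' _ <-]; exact: ymax.
Qed.

Lemma le_Phi x y : g (x, y) <= Phi g x.
Proof. by have [y0 y0max] := exists_maximizer x; rewrite (Phi_maximizer y0max). Qed.

(** Danskin's theorem in quantitative form.  The maximizer at [x] gives the
    lower bound.  For the upper bound use the maximizer at [x + v], which is within
    [l / mu] times the norm of [v] because the gradient in [y] vanishes there. *)
Lemma Phi_taylor x y v : 0 < l -> maximizer x y ->
  `|Phi g (x + v) - Phi g x - dot (gradx g (x, y)) v|
    <= (l + l * (l / mu)) * enorm v ^+ 2.
Proof.
move=> lp ymax; have [y' ymax'] := exists_maximizer (x + v).
have lk0 : 0 <= l / mu by rewrite divr_ge0 // ltW.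
rewrite ler_norml; apply/andP; split.
  have := le_Phi (x + v) y; rewrite (Phi_maximizer ymax).
  have := smooth_taylor_x gl x y v l0; rewrite ler_norml => /andP[+ _].
  have : 0 <= l * (l / mu) * enorm v ^+ 2 by rewrite mulr_ge0 ?sqr_ge0 // mulr_ge0.
  lra.
have := le_Phi x y'; rewrite (Phi_maximizer ymax').
have := smooth_taylor_x gl x y' v l0; rewrite ler_norml => /andP[_].
have dy : enorm (y' - y) <= l / mu * enorm v.
  rewrite mulrAC ler_pdivlMr // mulrC.
  apply: (le_trans (dist_maximizer y' lp ymax)).
  rewrite -[grady _ _]subr0 -(grady_maximizer lp ymax').
  apply: (le_trans (smooth_grady gl _ _)) => /=.
  by rewrite subrr enorm0 addr0 opprD addrA subrr sub0r enormN.
have : dot (gradx g (x, y') - gradx g (x, y)) v <= l * (l / mu) * enorm v ^+ 2.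
  apply: (le_trans (dot_le_enorm _ _)).
  rewrite expr2 mulrA ler_wpM2r ?enorm_ge0 // -mulrA.
  apply: (le_trans (smooth_gradx gl _ _)) => /=.
  by rewrite subrr enorm0 add0r ler_wpM2l.
rewrite dotBl; lra.
Qed.

Lemma grad_Phi x y : 0 < l -> maximizer x y -> grad (Phi g) x = gradx g (x, y).
Proof. by move=> lp ymax; apply: grad_taylor => v; apply: Phi_taylor. Qed.

End Max.

(** * One epoch *)

Lemma foldl_map (S T A : Type) (h : A -> T -> A) (k : S -> T) (z : A) (s : seq S) :
  foldl h z [seq k i | i <- s] = foldl (fun z i => h z (k i)) z s.
Proof. by elim: s z => /=. Qed.

Section Epoch.
Context {R : realType} {d n : nat}.
Variables (f : 'I_n -> 'rV[R]_d * 'rV[R]_d -> R) (l eta1 eta2 : R).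
Hypotheses (n0 : (0 < n)%N) (fl : forall i, smooth l (f i)) (l0 : 0 <= l).
Hypotheses (eta1_ge0 : 0 <= eta1) (eta2_ge0 : 0 <= eta2).
Hypothesis small : l * (eta1 + eta2) <= 6^-1.
Variable z0 : 'rV[R]_d * 'rV[R]_d.

Let F := average f.
Let a := enorm (gradx F z0).
Let b := enorm (grady F z0).
Let path (r : seq 'I_n) := foldl (fun z i => sgda_step f eta1 eta2 z0 z i) z0 r.

(** [M] bounds the distance travelled during an epoch: an estimator deviates from
    the full gradient by at most [l] times the distance travelled so far, and
    [eta1 a + eta2 b + l (eta1 + eta2) M <= M]. *)
Let M := 6 / 5 * (eta1 * a + eta2 * b).

Let M_ge0 : 0 <= M.
Proof. by rewrite mulr_ge0 // addr_ge0 // mulr_ge0 // enorm_ge0. Qed.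

Let M_fix : eta1 * a + eta2 * b + l * (eta1 + eta2) * M <= M.
Proof.
have : l * (eta1 + eta2) * M <= 6^-1 * M by rewrite ler_wpM2r.
rewrite /M; lra.
Qed.

(** The fraction of the epoch completed after the indices [r]. *)
Let s (r : seq 'I_n) : R := (size r)%:R / n%:R.

Let n_gt0 : 0 < n%:R :> R. Proof. by rewrite ltr0n. Qed.

Let s_ge0 r : 0 <= s r. Proof. by rewrite divr_ge0. Qed.

Let s_rcons r i : s (rcons r i) = s r + n%:R^-1.
Proof. by rewrite /s size_rcons -natr1 mulrDl mul1r. Qed.

Let path_rcons r i : path (rcons r i) = sgda_step f eta1 eta2 z0 (path r) i.
Proof. by rewrite /path -cats1 foldl_cat. Qed.

Let travel r := enorm ((path r).1 - z0.1) + enorm ((path r).2 - z0.2).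

Let dev_x r i : travel r <= s r * M ->
  enorm (gradx (f i) (path r) - gradx (f i) z0) <= l * (s r * M).
Proof.
by move=> rM; apply: (le_trans (smooth_gradx (fl i) _ _)); rewrite ler_wpM2l.
Qed.

Let dev_y r i : travel r <= s r * M ->
  enorm (grady (f i) (path r) - grady (f i) z0) <= l * (s r * M).
Proof.
by move=> rM; apply: (le_trans (smooth_grady (fl i) _ _)); rewrite ler_wpM2l.
Qed.

Let travel_le r : (size r <= n)%N -> travel r <= s r * M.
Proof.
elim/last_ind: r => [|r i ih]; first by rewrite /travel /path /= !subrr !enorm0 addr0 mulr_ge0.
rewrite size_rcons => rn; have {}ih := ih (ltnW rn).
have s1 : s r <= 1 by rewrite ler_pdivrMr // mul1r ler_nat ltnW.
have := dev_x i ih; have := dev_y i ih.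
rewrite /travel path_rcons s_rcons /sgda_step /= -/F -![_ _ z0 + _ - _]addrA.
set u := gradx (f i) _ - _; set v := grady (f i) _ - _ => hv hu.
have bound (c e : R) (w w0 G h : 'rV[R]_d) : 0 <= c -> enorm h <= e ->
    enorm (w + c / n%:R *: (G + h) - w0) <= enorm (w - w0) + c / n%:R * (enorm G + e).
  move=> c0 he; rewrite addrAC; apply: (le_trans (ler_enormD _ _)).
  rewrite lerD2l enormZ ger0_norm ?divr_ge0 // ler_wpM2l ?divr_ge0 //.
  by apply: (le_trans (ler_enormD _ _)); rewrite lerD2l.
have bx : enorm ((path r).1 - eta1 / n%:R *: (gradx F z0 + u) - z0.1)
    <= enorm ((path r).1 - z0.1) + eta1 / n%:R * (a + l * (s r * M)).
  have := bound eta1 (l * (s r * M)) (path r).1 z0.1 (- gradx F z0) (- u) eta1_ge0.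
  by rewrite !enormN -opprD scalerN; apply.
have byy := bound eta2 _ (path r).2 z0.2 (grady F z0) v eta2_ge0 hv.
apply: (le_trans (lerD bx byy)); rewrite -/b addrACA.
have sM : s r * M <= M by rewrite ler_piMl.
rewrite mulrDl; apply: lerD => //.
rewrite (mulrAC eta1) (mulrAC eta2) -mulrDl [leRHS]mulrC ler_wpM2r ?invr_ge0 //.
apply: le_trans M_fix.
have -> : eta1 * (a + l * (s r * M)) + eta2 * (b + l * (s r * M))
        = eta1 * a + eta2 * b + l * (eta1 + eta2) * (s r * M) by ring.
by rewrite lerD2l ler_wpM2l // mulr_ge0 // addr_ge0.
Qed.

(** As [s r <= 1], the deviation of each estimator is at most [l M], and the step
    taken so far averages these deviations. *)
Let path_x r : (size r <= n)%N ->
  exists2 e, (path r).1 = z0.1 - eta1 *: (s r *: gradx F z0 + e)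
    & enorm e <= s r * (l * M).
Proof.
elim/last_ind: r => [|r i ih].
  exists 0; last by rewrite enorm0 mulr_ge0 // mulr_ge0.
  by rewrite /s mul0r scale0r addr0 scaler0 subr0.
rewrite size_rcons => rn; have [e xr he] := ih (ltnW rn).
have hu := dev_x i (travel_le (ltnW rn)).
have s1 : s r <= 1 by rewrite ler_pdivrMr // mul1r ler_nat ltnW.
exists (e + n%:R^-1 *: (gradx (f i) (path r) - gradx (f i) z0)).
  rewrite path_rcons s_rcons /sgda_step /= xr -/F.
  apply/rowP => j; rewrite !mxE; ring.
apply: (le_trans (ler_enormD _ _)); rewrite s_rcons mulrDl lerD //.
rewrite enormZ ger0_norm ?invr_ge0 // ler_wpM2l ?invr_ge0 //.
by apply: (le_trans hu); rewrite ler_wpM2l // ler_piMl.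
Qed.

Let path_y r : (size r <= n)%N ->
  exists2 e, (path r).2 = z0.2 + eta2 *: (s r *: grady F z0 + e)
    & enorm e <= s r * (l * M).
Proof.
elim/last_ind: r => [|r i ih].
  exists 0; last by rewrite enorm0 mulr_ge0 // mulr_ge0.
  by rewrite /s mul0r scale0r addr0 scaler0 addr0.
rewrite size_rcons => rn; have [e xr he] := ih (ltnW rn).
have hu := dev_y i (travel_le (ltnW rn)).
have s1 : s r <= 1 by rewrite ler_pdivrMr // mul1r ler_nat ltnW.
exists (e + n%:R^-1 *: (grady (f i) (path r) - grady (f i) z0)).
  rewrite path_rcons s_rcons /sgda_step /= xr -/F.
  apply/rowP => j; rewrite !mxE; ring.
apply: (le_trans (ler_enormD _ _)); rewrite s_rcons mulrDl lerD //.
rewrite enormZ ger0_norm ?invr_ge0 // ler_wpM2l ?invr_ge0 //.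
by apply: (le_trans hu); rewrite ler_wpM2l // ler_piMl.
Qed.

(** An epoch is one simultaneous gradient step with small errors. *)
Lemma sgda_epoch_step (p : 'S_n) : exists ex ey : 'rV[R]_d,
  [/\ sgda_epoch f eta1 eta2 p z0
        = (z0.1 - eta1 *: (gradx F z0 + ex), z0.2 + eta2 *: (grady F z0 + ey)),
      enorm ex <= l * M & enorm ey <= l * M].
Proof.
pose r := [seq p j | j <- enum 'I_n].
have -> : sgda_epoch f eta1 eta2 p z0 = path r by rewrite /path foldl_map.
have sz : size r = n by rewrite size_map size_enum_ord.
have s1 : s r = 1 by rewrite /s sz divff // gt_eqF.
have [|ex hx ?] := @path_x r; first by rewrite sz.
have [|ey hy ?] := @path_y r; first by rewrite sz.
exists ex, ey; rewrite [path r]surjective_pairing hx hy s1 !scale1r.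
by split=> //; rewrite -[leRHS]mul1r -s1.
Qed.

End Epoch.

(** * Descent of the potential *)

(** The arithmetic of the descent.  Here [a], [b], [p] stand for the norms of
    [gradx F], [grady F] and [grad Phi], [G] and [H] for those of the averaged
    estimators, and [E] bounds their errors.  In terms of [A = l eta1] and [B = l eta2]
    the step sizes satisfy [B <= 1 / 8] and [A k^2 <= B / 14]; this makes [E] at most
    [6 / 5 A p + 9 / 56 b].  The error terms in [b] are then multiples of
    [eta2 b^2] that add up to less than the gain [eta2 b^2], and the terms
    in [A p] are negligible against [eta1 p^2] because
    [eta2 (A p)^2 = A B eta1 p^2]. *)
Lemma descent_arith (R : realFieldType) (l k eta1 eta2 a b p G H E : R) :
  0 < l -> 1 <= k -> 0 < eta1 -> 0 < eta2 ->
  8 * (l * eta2) <= 1 -> 14 * k ^+ 2 * eta1 <= eta2 ->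
  0 <= b -> 0 <= p -> 0 <= a -> 0 <= G -> 0 <= H -> 0 <= E ->
  a <= p + k * b -> H <= b + E -> E <= l * (6 / 5 * (eta1 * a + eta2 * b)) ->
  eta1 * (- 2 * p ^+ 2 - 2 * G ^+ 2 + 2 * (k * b + E) ^+ 2 + k * b * G)
    + 5 * ((l + l * k) * (eta1 * G) ^+ 2)
    - eta2 * (b ^+ 2 - b * E) + l * (eta1 * G + eta2 * H) ^+ 2 <= - (eta1 * p ^+ 2).
Proof.
move=> l0 k1 e1 e2 hB hr b0 p0 a0 G0 H0 E0 ha hH hE.
have k0 : 0 < k by apply: lt_le_trans k1.
pose A := l * eta1; pose B := l * eta2; pose q := A * p.
have A0 : 0 < A by rewrite mulr_gt0.
have B0 : 0 < B by rewrite mulr_gt0.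
have hB' : B <= 8^-1 by rewrite /B; lra.
have q0 : 0 <= q by rewrite mulr_ge0 // ltW.
have AkB : 14 * (A * k ^+ 2) <= B.
  have : l * (14 * k ^+ 2 * eta1) <= l * eta2 by rewrite ler_wpM2l // ltW.
  rewrite /A /B; lra.
have AAk : A <= A * k by rewrite ler_peMr // ltW.
have AkAkk : A * k <= A * k ^+ 2 by rewrite expr2 mulrA ler_peMr // mulr_ge0 // ltW.
have Ak : A * k <= 112^-1 by lra.
have A112 : A <= 112^-1 by lra.
have hkb : 14 * (eta1 * (k * b) ^+ 2) <= eta2 * b ^+ 2.
  have := ler_wpM2r (sqr_ge0 b) hr.
  by have -> : 14 * k ^+ 2 * eta1 * b ^+ 2 = 14 * (eta1 * (k * b) ^+ 2) by ring.
have hq : eta2 * q ^+ 2 <= 112^-1 * 8^-1 * (eta1 * p ^+ 2).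
  have -> : eta2 * q ^+ 2 = A * B * (eta1 * p ^+ 2) by rewrite /q /A /B; ring.
  apply: ler_wpM2r; first by rewrite mulr_ge0 ?sqr_ge0 ?(ltW e1).
  by apply: ler_pM => //; exact: ltW.
have e12 : 14 * eta1 <= eta2.
  apply: le_trans hr; rewrite -mulrA ler_pM2l // ler_peMl ?(ltW e1) //.
  by rewrite expr_ge1 // ltW.
have hE1 : E <= 6 / 5 * q + 9 / 56 * b.
  apply: (le_trans hE).
  have h1 : A * a <= A * (p + k * b) by rewrite ler_wpM2l // ltW.
  have h2 : A * k * b <= 112^-1 * b by rewrite ler_wpM2r.
  have h3 : B * b <= 8^-1 * b by rewrite ler_wpM2r.
  move: h1 h2 h3; rewrite /q /B /A; lra.
have hE2 : E ^+ 2 <= 3 * q ^+ 2 + 3 / 50 * b ^+ 2.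
  have : E ^+ 2 <= (6 / 5 * q + 9 / 56 * b) ^+ 2.
    by rewrite ler_pXn2r // nnegrE addr_ge0 // mulr_ge0 // divr_ge0.
  have := sqr_ge0 (q - 10^-1 * b).
  have := sqr_ge0 (6 / 5 * q - 9 / 56 * b); have := sqr_ge0 q; have := sqr_ge0 b.
  lra.
have hbE : b * E <= 26 / 100 * b ^+ 2 + 4 * q ^+ 2.
  have : b * E <= b * (6 / 5 * q + 9 / 56 * b) by rewrite ler_wpM2l.
  have := sqr_ge0 (2 * q - 3 / 10 * b); have := sqr_ge0 b; lra.
have hkbE : (k * b + E) ^+ 2 <= 3 / 2 * (k * b) ^+ 2 + 3 * E ^+ 2.
  have := sqr_ge0 (k * b - 2 * E); lra.
have hkbG : k * b * G <= G ^+ 2 / 2 + (k * b) ^+ 2 / 2.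
  have := sqr_ge0 (k * b - G); lra.
have hH2 : H ^+ 2 <= b ^+ 2 + 2 * (b * E) + E ^+ 2.
  have : H ^+ 2 <= (b + E) ^+ 2 by rewrite ler_pXn2r // nnegrE addr_ge0.
  lra.
have hGH : l * (eta1 * G + eta2 * H) ^+ 2 <= 2 * (A * (eta1 * G ^+ 2)) + 2 * (B * (eta2 * H ^+ 2)).
  have : 0 <= l * (eta1 * G - eta2 * H) ^+ 2 by rewrite mulr_ge0 ?sqr_ge0 // ltW.
  rewrite /A /B; lra.
have hAG : A * (eta1 * G ^+ 2) <= 112^-1 * (eta1 * G ^+ 2).
  by rewrite ler_wpM2r ?mulr_ge0 ?sqr_ge0 // ltW.
have hAkG : (A * k) * (eta1 * G ^+ 2) <= 112^-1 * (eta1 * G ^+ 2).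
  by rewrite ler_wpM2r ?mulr_ge0 ?sqr_ge0 // ltW.
have hBH : B * (eta2 * H ^+ 2) <= 8^-1 * (eta2 * H ^+ 2).
  by rewrite ler_wpM2r ?mulr_ge0 ?sqr_ge0 // ltW.
have w1 : eta1 * E ^+ 2 <= 3 * (eta1 * q ^+ 2) + 3 / 50 * (eta1 * b ^+ 2).
  by have := ler_wpM2l (ltW e1) hE2; rewrite mulrDr !(mulrCA eta1).
have w2 : eta2 * E ^+ 2 <= 3 * (eta2 * q ^+ 2) + 3 / 50 * (eta2 * b ^+ 2).
  by have := ler_wpM2l (ltW e2) hE2; rewrite mulrDr !(mulrCA eta2).
have w3 : eta2 * (b * E) <= 26 / 100 * (eta2 * b ^+ 2) + 4 * (eta2 * q ^+ 2).
  by have := ler_wpM2l (ltW e2) hbE; rewrite mulrDr !(mulrCA eta2 (_ / _)) (mulrCA eta2 4).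
have w4 : eta1 * (k * b + E) ^+ 2
    <= 3 / 2 * (eta1 * (k * b) ^+ 2) + 3 * (eta1 * E ^+ 2).
  by have := ler_wpM2l (ltW e1) hkbE; rewrite mulrDr !(mulrCA eta1 (_ / _)) (mulrCA eta1 3).
have w5 : eta1 * (k * b * G) <= eta1 * G ^+ 2 / 2 + eta1 * (k * b) ^+ 2 / 2.
  by have := ler_wpM2l (ltW e1) hkbG; rewrite mulrDr !mulrA.
have w6 : eta2 * H ^+ 2 <= eta2 * b ^+ 2 + 2 * (eta2 * (b * E)) + eta2 * E ^+ 2.
  by have := ler_wpM2l (ltW e2) hH2; rewrite !mulrDr (mulrCA eta2 2).
have w7 := ler_wpM2r (sqr_ge0 q) e12.
have w8 := ler_wpM2r (sqr_ge0 b) e12.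
have w9 : 0 <= eta1 * G ^+ 2 by rewrite mulr_ge0 ?sqr_ge0 // ltW.
have w10 : 0 <= eta2 * b ^+ 2 by rewrite mulr_ge0 ?sqr_ge0 // ltW.
have w11 : 0 <= eta2 * q ^+ 2 by rewrite mulr_ge0 ?sqr_ge0 // ltW.
have w12 : 0 <= eta1 * p ^+ 2 by rewrite mulr_ge0 ?sqr_ge0 // ltW.
have -> : eta1 * (- 2 * p ^+ 2 - 2 * G ^+ 2 + 2 * (k * b + E) ^+ 2 + k * b * G)
    + 5 * ((l + l * k) * (eta1 * G) ^+ 2) - eta2 * (b ^+ 2 - b * E)
  = - 2 * (eta1 * p ^+ 2) - 2 * (eta1 * G ^+ 2) + 2 * (eta1 * (k * b + E) ^+ 2)
    + eta1 * (k * b * G) + 5 * (A * (eta1 * G ^+ 2) + A * k * (eta1 * G ^+ 2))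
    - eta2 * b ^+ 2 + eta2 * (b * E).
  by rewrite /A; ring.
rewrite -!mulrA in w7 w8.
move: hGH hAG hAkG hBH hkb hq w1 w2 w3 w4 w5 w6 w7 w8 w9 w10 w11 w12.
(* From here on the inequality is linear in the following monomials. *)
move: (eta1 * (k * b + E) ^+ 2) (eta1 * (k * b * G)) (eta2 * (b * E)) (eta2 * H ^+ 2)
  (eta1 * E ^+ 2) (eta2 * E ^+ 2) (eta1 * (k * b) ^+ 2) (l * _ ^+ 2)
  (A * k * (eta1 * G ^+ 2)) (A * (eta1 * G ^+ 2)) (B * _).
move: (eta1 * p ^+ 2) (eta1 * G ^+ 2) (eta2 * b ^+ 2) (eta2 * q ^+ 2) (eta1 * b ^+ 2) (eta1 * q ^+ 2).
clear => *; lra.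
Qed.

(** Adds the Taylor bounds for Phi and for [F] with the weights [5] and [-1] that they have
    in the potential; of [- 5 ug + wg], the part [wg - ug] is a perturbation. *)
Lemma descent_combine (R : realFieldType) (Phi1 Phi0 S F1 F0 X Q V T P ug wg vg : R) :
  Phi1 - Phi0 - - ug <= Q -> - T <= F1 - F0 - (- wg + vg) ->
  - 4 * ug + (wg - ug) <= X -> V <= vg -> X + 5 * Q - V + T <= - P ->
  4 * (Phi1 - S) + Phi1 - F1 <= 4 * (Phi0 - S) + Phi0 - F0 - P.
Proof. by lra. Qed.

Section Descent.
Context {R : realType} {d n : nat}.
Variables (f : 'I_n -> 'rV[R]_d * 'rV[R]_d -> R) (l mu eta1 eta2 r : R).
Let F := average f.
Let kappa := l / mu.
Hypotheses (n0 : (0 < n)%N) (fl : forall i, smooth l (f i)) (mu0 : 0 < mu).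
Hypothesis Fmu : forall x, strongly_concave mu (fun y => F (x, y)).
Hypotheses (kappa1 : 1 <= kappa) (eta2_gt0 : 0 < eta2) (eta2_le : eta2 <= 1 / (8 * l)).
Hypotheses (r_ge : 14 * kappa ^+ 2 <= r) (eta1E : eta1 = eta2 / r).
Implicit Types (z : 'rV[R]_d * 'rV[R]_d) (p : 'S_n).

Let l_gt0 : 0 < l.
Proof.
have : 0 < kappa by apply: lt_le_trans kappa1.
by rewrite pmulr_lgt0 ?invr_gt0.
Qed.

Let Fl : smooth l F. Proof. exact: smooth_average. Qed.

Let r_gt0 : 0 < r.
Proof. by apply: lt_le_trans r_ge; rewrite mulr_gt0 // exprn_gt0 // (lt_le_trans _ kappa1). Qed.

Lemma stepsize_gt0 : 0 < eta1.
Proof. by rewrite eta1E divr_gt0. Qed.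

Let l_eta2 : 8 * (l * eta2) <= 1.
Proof. by move: eta2_le; rewrite ler_pdivlMr ?mulr_gt0 // mulrC mulrA. Qed.

Let eta12 : 14 * kappa ^+ 2 * eta1 <= eta2.
Proof. by rewrite eta1E mulrCA ler_piMr ?(ltW eta2_gt0) // ler_pdivrMr // mul1r. Qed.

(** Taylor bounds for Phi and [F] along the step of one epoch, with
    [grad Phi] compared to [gradx F] through the distance to the maximizer. *)
Lemma potential_epoch z p :
  potential F 4 (sgda_epoch f eta1 eta2 p z)
    <= potential F 4 z - eta1 * enorm (grad (Phi F) z.1) ^+ 2.
Proof.
have e1 := stepsize_gt0; have l0 := ltW l_gt0.
have small : l * (eta1 + eta2) <= 6^-1.
  have h : l * (14 * eta1) <= l * eta2.
    rewrite ler_wpM2l //; apply: le_trans eta12.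
    by rewrite ler_wpM2r ?(ltW e1) // ler_peMr // expr_ge1 // (le_trans ler01).
  move: h l_eta2; lra.
have [ex [ey [-> hex hey]]] :=
  sgda_epoch_step n0 fl l0 (ltW e1) (ltW eta2_gt0) small z p.
have [ys ysmax] := exists_maximizer Fl l0 mu0 Fmu z.1.
rewrite (grad_Phi Fl l0 mu0 Fmu l_gt0 ysmax) -/F in hex hey *.
set u := gradx F (z.1, ys); set w := gradx F z in hex hey *; set v := grady F z in hex hey *.
set gx := w + ex; set gy := v + ey.
have hPhi := Phi_taylor Fl l0 mu0 Fmu (- (eta1 *: gx)) l_gt0 ysmax.
have hF := smooth_taylor Fl z (- (eta1 *: gx), eta2 *: gy) l0.
have wu : enorm (w - u) <= kappa * enorm v.
  rewrite /w /u (surjective_pairing z) /=.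
  apply: (le_trans (smooth_gradx Fl _ _)) => /=.
  rewrite subrr enorm0 add0r /kappa -mulrA ler_wpM2l // ler_pdivlMl //.
  by have := dist_maximizer Fl l0 mu0 Fmu z.2 l_gt0 ysmax; rewrite -surjective_pairing.
move: hPhi hF; rewrite /= -/u -/w -/v !ler_norml => /andP[_ hPhi] /andP[hF _].
rewrite !enormN !enormZ !(ger0_norm (ltW _)) // in hPhi hF.
rewrite !dotNr !dotZr in hPhi hF.
pose E := l * (6 / 5 * (eta1 * enorm w + eta2 * enorm v)).
have E0 : 0 <= E by rewrite /E !(mulr_ge0, addr_ge0) ?enorm_ge0 // ltW.
(* Polarization: [- 2 dot u gx] is [|gx - u|^2 - |u|^2 - |gx|^2]. *)
have ugx : - 4 * dot u gx + dot (w - u) gx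
    <= - 2 * enorm u ^+ 2 - 2 * enorm gx ^+ 2 + 2 * (kappa * enorm v + E) ^+ 2
       + kappa * enorm v * enorm gx.
  have h1 : dot (w - u) gx <= kappa * enorm v * enorm gx.
    by apply: (le_trans (dot_le_enorm _ _)); rewrite ler_wpM2r ?enorm_ge0.
  have h2 : enorm (gx - u) ^+ 2 <= (kappa * enorm v + E) ^+ 2.
    have h : enorm (gx - u) <= kappa * enorm v + E.
      by rewrite /gx addrAC (le_trans (ler_enormD _ _)) // lerD.
    by rewrite ler_pXn2r // nnegrE ?enorm_ge0 // (le_trans (enorm_ge0 _) h).
  have e : enorm (gx - u) ^+ 2 = enorm gx ^+ 2 - 2 * dot u gx + enorm u ^+ 2.
    by rewrite !sqr_enorm dotBl !dotBr (dotC gx u); ring.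
  have -> : - 4 * dot u gx = - 2 * enorm u ^+ 2 - 2 * enorm gx ^+ 2
      + 2 * enorm (gx - u) ^+ 2 by rewrite e; ring.
  by rewrite lerD // lerD2l ler_pM2l.
have vgy : enorm v ^+ 2 - enorm v * E <= dot v gy.
  rewrite sqr_enorm /gy dotDr lerD2l lerNl -dotNr.
  apply: (le_trans (dot_le_enorm _ _)); rewrite enormN ler_wpM2l ?enorm_ge0 //.
have ha : enorm w <= enorm u + kappa * enorm v.
  by rewrite -[w](subrK u) addrC (le_trans (ler_enormD _ _)) // lerD2l.
have hgy : enorm gy <= enorm v + E by rewrite (le_trans (ler_enormD _ _)) // lerD2l.
have key := descent_arith l_gt0 kappa1 e1 eta2_gt0 l_eta2 eta12 (enorm_ge0 v)
  (enorm_ge0 u) (enorm_ge0 w) (enorm_ge0 gx) (enorm_ge0 gy) E0 ha hgy (lexx _).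
apply: descent_combine hPhi hF _ (ler_wpM2l (ltW eta2_gt0) vgy) key.
by have := ler_wpM2l (ltW e1) ugx; rewrite dotBl mulrDr mulrBr mulrCA.
Qed.

Hypothesis Phi_lb : has_lbound (range (Phi F)).

Lemma potential_ge0 z : 0 <= potential F 4 z.
Proof.
rewrite /potential -addrA addr_ge0 //.
  by rewrite mulr_ge0 // subr_ge0; apply: ge_inf => //; exists z.1.
by rewrite subr_ge0 {1}(surjective_pairing z) (le_Phi Fl (ltW l_gt0) mu0 Fmu).
Qed.

Lemma sum_sqr_grad_Phi (s : nat -> 'S_n) z0 t :
  \sum_(k < t) enorm (grad (Phi F) (sgda f eta1 eta2 s z0 k).1) ^+ 2
    <= potential F 4 z0 / eta1.
Proof.
suff h : eta1 * \sum_(k < t) enorm (grad (Phi F) (sgda f eta1 eta2 s z0 k).1) ^+ 2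
    <= potential F 4 z0 - potential F 4 (sgda f eta1 eta2 s z0 t).
  rewrite ler_pdivlMr ?stepsize_gt0 // mulrC; apply: (le_trans h).
  by rewrite gerBl potential_ge0.
elim: t => [|t ih]; first by rewrite big_ord0 mulr0 /= subrr.
rewrite big_ord_recr mulrDr /=.
apply: (le_trans (lerD ih (lexx _))).
by have := potential_epoch (sgda f eta1 eta2 s z0 t) (s t); lra.
Qed.

(** Cauchy-Schwarz turns the bound on the sum of squares into a bound on the sum of
    norms, to which the expectation applies linearly. *)
Lemma sum_grad_Phi (s : nat -> 'S_n) z0 t :
  \sum_(k < t) enorm (grad (Phi F) (sgda f eta1 eta2 s z0 k).1)
    <= Num.sqrt (t%:R * (potential F 4 z0 / eta1)).
Proof.
pose u := \row_(k < t) enorm (grad (Phi F) (sgda f eta1 eta2 s z0 k).1).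
have -> : \sum_(k < t) enorm (grad (Phi F) (sgda f eta1 eta2 s z0 k).1) = dot (const_mx 1) u.
  by apply: eq_bigr => k _; rewrite !mxE mul1r.
apply: (le_trans (dot_le_enorm _ _)); rewrite sqrtrM ?ler0n //; apply: ler_pM.
- exact: enorm_ge0.
- exact: enorm_ge0.
- rewrite /enorm; under eq_bigr do rewrite mxE expr1n.
  by rewrite sumr_const card_ord.
- rewrite /enorm; under eq_bigr do rewrite mxE.
  by rewrite ler_wsqrtr // sum_sqr_grad_Phi.
Qed.

End Descent.

(** * Oracle complexity *)

Section Oracle.
Context {R : realType} {d n : nat}.
Variable f : 'I_n -> 'rV[R]_d * 'rV[R]_d -> R.

Lemma run_bind (A B : Type) (p : prog R d n A) (k : A -> prog R d n B) :
  run f (bind p k) = ((run f (k (run f p).1)).1,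
                      ((run f p).2 + (run f (k (run f p).1)).2)%N).
Proof.
elim: p => [a|i z q ih] /=; first by case: (run f (k a)).
by rewrite ih; case: (run f (q _)) => a c /=.
Qed.

Lemma run_gradients_prog z (s : seq 'I_n) :
  {in s, (run f (gradients_prog z s)).1 =1 fun i => (gradx (f i) z, grady (f i) z)} /\
  (run f (gradients_prog z s)).2 = size s.
Proof.
elim: s => [|i s [ih1 ih2]] //=; rewrite run_bind /= ih2 addn0; split=> // j.
by rewrite inE; case: eqVneq => [->|_] //=; exact: ih1.
Qed.

Lemma run_inner_prog eta1 eta2 (G : 'I_n -> 'rV[R]_d * 'rV[R]_d) z0 z (s : seq 'I_n) :
  (forall i y, differentiable (f i) y) ->
  (forall i, G i = (gradx (f i) z0, grady (f i) z0)) ->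
  run f (inner_prog eta1 eta2 G s z)
    = (foldl (fun z i => sgda_step f eta1 eta2 z0 z i) z s, size s).
Proof.
move=> df GE; elim: s z => [|i s ih] z //=.
rewrite ih /sgda_step GE gradx_average // grady_average //.
by under eq_bigr do rewrite GE; under [in X in z.2 + X]eq_bigr do rewrite GE.
Qed.

Lemma run_sgda_prog eta1 eta2 (s : nat -> 'S_n) z0 t :
  (forall i y, differentiable (f i) y) ->
  run f (sgda_prog eta1 eta2 s z0 t) = (sgda f eta1 eta2 s z0 t, (2 * n * t)%N).
Proof.
move=> df; elim: t => [|t ih] /=; first by rewrite muln0.
rewrite !run_bind ih /=.
set z := sgda f eta1 eta2 s z0 t.
have [G1 ->] := run_gradients_prog z (enum 'I_n).
rewrite (@run_inner_prog _ _ _ z) //; last by move=> i; apply: G1; rewrite mem_enum.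
rewrite /= size_map size_enum_ord foldl_map mulnS mul2n -addnn.
by rewrite addnC.
Qed.

End Oracle.

(** * Expectations over the permutations *)

Section Expectation.
Context {R : realType} {disp : measure_display} {T : measurableType disp}.
Variable P : probability T R.

Lemma measurable_shuffling n sch (X : nat -> T -> 'S_n) (t : nat) (s : 'S_n) :
  shuffling P sch X -> measurable (X t @^-1` [set s]).
Proof.
case: sch => /= [[s0 Xs]|[U X0]|[U _]]; last by have [] := U t s.
- have [ss|ss] := eqVneq s0 s.
    by rewrite (_ : _ @^-1` _ = setT) // -subTset => w _ /=; rewrite Xs.
  rewrite (_ : _ @^-1` _ = set0) // -subset0 => w /=; rewrite Xs => /eqP.
  by rewrite (negPf ss).
- rewrite (_ : _ @^-1` _ = X 0%N @^-1` [set s]); first by have [] := U s.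
  by apply/seteqP; split=> w /=; rewrite X0.
Qed.

(** The iterates take finitely many values: split the event according to the
    permutation of the last epoch. *)
Lemma measurable_sgda d n (f : 'I_n -> 'rV[R]_d * 'rV[R]_d -> R) eta1 eta2
    (X : nat -> T -> 'S_n) z0 (t : nat) (A : set ('rV[R]_d * 'rV[R]_d)) :
  (forall t s, measurable (X t @^-1` [set s])) ->
  measurable [set w | A (sgda f eta1 eta2 (fun k => X k w) z0 t)].
Proof.
move=> mX; elim: t A => [|t ih] A /=.
  have [Az|Az] := pselect (A z0).
    by rewrite (_ : [set _ | _] = setT) // -subTset.
  by rewrite (_ : [set _ | _] = set0) // -subset0.
rewrite (_ : [set _ | _] = \bigcup_(s in [set: 'S_n]) (X t @^-1` [set s] `&`
    [set w | (sgda_epoch f eta1 eta2 s @^-1` A) (sgda f eta1 eta2 (fun k => X k w) z0 t)])).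
  apply: fin_bigcup_measurable => [|s _]; first exact: finite_finset.
  exact: measurableI.
apply/seteqP; split=> w /=; first by exists (X t w).
by case=> s _ [/= ->].
Qed.

(** If all the expectations exceeded [eps], so would their average, but the expectation of
    the sum is at most [c]. *)
Lemma exists_expectation_le (h : nat -> T -> R) (N : nat) (c eps : R) :
  (forall k, measurable_fun setT (h k)) -> (forall k w, 0 <= h k w) ->
  (forall w, \sum_(k < N) h k w <= c) -> c < N%:R * eps ->
  exists2 k, (k < N)%N & ('E_P[h k] <= eps%:E)%E.
Proof.
move=> mh h0 hN cN; apply: contrapT => nk.
have lt_eps (k : 'I_N) : (eps%:E < 'E_P[h k])%E.
  by rewrite ltNge; apply/negP => hk; apply: nk; exists k.
have : (\sum_(k < N) 'E_P[h k] <= c%:E)%E.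
  have -> : (\sum_(k < N) 'E_P[h k] = \int[P]_w \sum_(k < N) (h k w)%:E)%E.
    rewrite (@ge0_integral_sum _ _ _ P setT measurableT _ (fun (k : 'I_N) w => (h k w)%:E)).
    - by apply: eq_bigr => k _; rewrite unlock.
    - by move=> k; apply/measurable_realfun.measurable_EFinP.
    - by move=> k w _; rewrite lee_fin.
  apply: (@le_trans _ _ (\int[P]_w c%:E)%E).
    apply: ge0_le_integral => //.
    - by move=> w _; apply: sume_ge0 => k _; rewrite lee_fin.
    - by apply: emeasurable_sum => k; apply/measurable_realfun.measurable_EFinP.
    - by move=> w _; rewrite sumEFin lee_fin.
  by have := expectation_cst P c; rewrite unlock => ->.
apply/negP; rewrite -ltNge.
apply: (@lt_le_trans _ _ (\sum_(k < N) eps%:E)%E).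
  by rewrite sumEFin lte_fin sumr_const card_ord -mulr_natl.
by apply: lee_sum => k _; exact: ltW.
Qed.

End Expectation.

(** * Complexity of the algorithm *)

Theorem mainTheorem2 (R : realType) :
  exists C : R -> R -> R -> R -> R,
  forall (d n : nat) (f : 'I_n -> 'rV[R]_d * 'rV[R]_d -> R)
    (l mu eta1 eta2 r c1 c2 : R) (x0 y0 : 'rV[R]_d)
    (disp : measure_display) (T : measurableType disp) (P : probability T R)
    (sch : scheme) (pi : nat -> T -> 'S_n),
  let F := average f in
  let kappa := l / mu in
  let K := C c1 c2 l (potential F 4 (x0, y0)) in
  (0 < n)%N ->
  (forall i, smooth l (f i)) ->
  0 < mu ->
  (forall x, strongly_concave mu (fun y => F (x, y))) ->
  1 <= kappa ->
  has_lbound (range (Phi F)) ->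
  0 < eta2 -> eta2 <= 1 / (8 * l) ->
  14 * kappa ^+ 2 <= r -> eta1 = eta2 / r ->
  0 < c1 -> c1 / (kappa ^+ 2 * l) <= eta1 ->
  0 < c2 -> c2 / l <= eta2 ->
  shuffling P sch pi ->
  0 < K /\
  forall eps : R, 0 < eps ->
  exists t : nat,
    [/\ t%:R <= K * kappa ^+ 2 * eps ^- 2,
        ('E_P[fun w => enorm (grad (Phi F)
                (sgda f eta1 eta2 (fun k => pi k w) (x0, y0) t).1)]
           <= eps%:E)%E
      & forall w : T,
          let s := fun k => pi k w in
          let output := run f (sgda_prog eta1 eta2 s (x0, y0) t) in
          output.1 = sgda f eta1 eta2 s (x0, y0) t /\
          output.2%:R <= K * n%:R * kappa ^+ 2 * eps ^- 2].
Proof.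
(* The factor [2] pays for the two gradients per component and epoch, and [+ 1]
   keeps the constant positive when the potential vanishes. *)
exists (fun c1 _ l pot => 2 * (pot * l / c1) + 1).
move=> d n f l mu eta1 eta2 r c1 c2 x0 y0 disp T P sch pi F kappa K n0 fl mu0 Fmu
  kappa1 Phi_lb eta2_gt0 eta2_le r_ge eta1E c1_gt0 eta1_ge _ _ hpi.
have kappa_gt0 : 0 < kappa by apply: lt_le_trans kappa1.
have kappa2_gt0 : 0 < kappa ^+ 2 by exact: exprn_gt0.
have l_gt0 : 0 < l by move: kappa_gt0; rewrite pmulr_lgt0 ?invr_gt0.
have eta1_gt0 := stepsize_gt0 kappa1 eta2_gt0 r_ge eta1E.
set z0 := (x0, y0); pose pot := potential F 4 z0.
have pot0 : 0 <= pot by exact: (potential_ge0 n0 fl mu0 Fmu kappa1 Phi_lb).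
pose A := pot * l / c1.
have A0 : 0 <= A by rewrite divr_ge0 ?mulr_ge0 // ltW.
have KE : K = 2 * A + 1 by [].
have df i z : differentiable (f i) z by case: (fl i).
split=> [|eps eps0]; first by rewrite KE ltr_wpDl // mulr_ge0.
pose X := kappa ^+ 2 * eps ^- 2.
have X0 : 0 < X by rewrite mulr_gt0 // invr_gt0 exprn_gt0.
(* The epochs with index below [N] suffice, and the last of them has index at most
   [A X]; in particular [N = 1] when [A X < 1]. *)
pose N := (Num.truncn (A * X)).+1.
have [NA AN] := andP (truncn_itv (mulr_ge0 A0 (ltW X0))).
pose h k w := enorm (grad (Phi F) (sgda f eta1 eta2 (fun k => pi k w) z0 k).1).
have mh k : measurable_fun setT (h k).
  move=> _ Y mY; rewrite setTI.
  apply: (measurable_sgda _ _ _ _ _ ((fun z => enorm (grad (Phi F) z.1)) @^-1` Y)) => t s.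
  exact: measurable_shuffling hpi.
have potB : pot / eta1 <= A * kappa ^+ 2.
  move: eta1_ge; rewrite ler_pdivrMr; last by exact: mulr_gt0.
  move=> h1.
  rewrite ler_pdivrMr // /A.
  have -> : pot * l / c1 * kappa ^+ 2 * eta1 = pot * (eta1 * (kappa ^+ 2 * l) / c1) by ring.
  by rewrite ler_peMr // ler_pdivlMr // mul1r.
have cN : Num.sqrt (N%:R * (pot / eta1)) < N%:R * eps.
  have Ne0 : 0 < N%:R * eps by rewrite mulr_gt0 ?ltr0n.
  rewrite -(ltr_pXn2r (n := 2)) ?nnegrE ?sqrtr_ge0 ?(ltW Ne0) //.
  rewrite sqr_sqrtr; last by rewrite mulr_ge0 ?ler0n // divr_ge0 // ltW.
  rewrite exprMn expr2 -!mulrA ltr_pM2l ?ltr0n //.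
  apply: (le_lt_trans potB).
  by rewrite -ltr_pdivrMr ?exprn_gt0 // -mulrA; exact: AN.
have [t tN ht] := exists_expectation_le P mh (fun k w => enorm_ge0 _)
  (fun w => sum_grad_Phi n0 fl mu0 Fmu kappa1 eta2_gt0 eta2_le r_ge eta1E Phi_lb
     (fun k => pi k w) z0 N) cN.
have tA : t%:R <= A * X by apply: le_trans NA; rewrite ler_nat.
have AX : 0 <= A * X by rewrite mulr_ge0 // ltW.
exists t; split=> // [|w s output].
  rewrite KE -mulrA -/X; move: X0 AX tA; rewrite mulrDl; lra.
rewrite /output run_sgda_prog //=; split=> //.
have -> : K * n%:R * kappa ^+ 2 * eps ^- 2 = n%:R * (2 * (A * X) + X).
  by rewrite KE /X; ring.
have -> : (2 * n * t)%:R = n%:R * (2 * t%:R) :> R by rewrite !natrM; ring.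
by rewrite ler_pM2l ?ltr0n // ler_wpDr ?(ltW X0) // ler_pM2l.
Qed.
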